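(* Let $d\ge2$, $T,\zeta_t,\zeta_x>0$, $S=-\log T$, and let $u:\mathbb{R}^d\times(-T,0)\to\mathbb{R}^d$ be a vector field of the form $$u(x,t)=\frac1{(-t)^{\zeta_t}}U(y,s),\qquad y=\frac{x}{(-t)^{\zeta_x}},\quad s=-\log(-t),$$ where $U:\mathbb{R}^d\times(S,+\infty)\to\mathbb{R}^d$ is smooth in $y$ and, for every $k\in\mathbb{N}_0$, there exist $C_k,c_k,R_k>0$ such that $$\sup_{s\in(S,+\infty)}\|\nabla_y^kU(\cdot,s)\|_{L^\infty}\le C_k,$$ $$\sup_{s\in(S,+\infty)}|\nabla_y^kU(y,s)|\to0\ \text{ as }|y|\to+\infty,$$ $$\inf_{s\in(S,+\infty)}\|\nabla_y^kU(\cdot,s)\|_{L^\infty(B_{R_k})}\ge c_k.$$ Let $k\in\mathbb{N}_0$ and $\bar\alpha_k=\frac1{k+\frac d2}$. Then the following are equivalent: 1. (Locally finite kinetic energy) $\sup_{t\in(-T,0)}\|u(\cdot,t)\|_{L^2(B_{(-t)^{\zeta_x}R_0})}<+\infty$. 2. (Sparsity) $u$ belongs to $Z^{(k)}_{\bar\alpha_k}$ uniformly in $t\in(-T,0)$. 3. (Exponents) $\zeta_t\le d\,\zeta_x/2$.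
   Context: Balls $B_R$ are centered at the origin of $\mathbb{R}^d$; $\mathbb{N}_0=\{0,1,2,\dots\}$. Sparseness in $L^\infty$: for $\varepsilon,\beta\in(0,1)$ and $\ell>0$, a (tensor-valued) function $g\in L^\infty(\mathbb{R}^d)$ is $(\varepsilon,\beta,\ell)$-sparse in $L^\infty$ if there is a measurable set $\Sigma\subset\mathbb{R}^d$ with $\|g\|_{L^\infty(\Sigma^c)}<\beta\|g\|_{L^\infty}$ and $\sup_{x_0\in\mathbb{R}^d}|\Sigma\cap B_\ell(x_0)|/|B_\ell(x_0)|\le\varepsilon$. The class $Z^{(k)}_\alpha$ ($k\in\mathbb{N}_0$, $\alpha>0$): $f\in Z^{(k)}_\alpha$ if $\nabla^kf$ is $(\varepsilon,\beta,\ell)$-sparse in $L^\infty$ for some scale $\ell$ with $K^{-1}\|\nabla^kf\|_{L^\infty}^{-\alpha}\le\ell\le K\|\nabla^kf\|_{L^\infty}^{-\alpha}$; the class implicitly depends on the parameters $\varepsilon,\beta\in(0,1)$ (arbitrary but fixed) and on the constant $K\ge1$. ''$u$ belongs to $Z^{(k)}_\alpha$ uniformly in $t\in(-T,0)$'' means: with $\varepsilon,\beta\in(0,1)$ fixed, there is a constant $K\ge1$ independent of $t$ such that for every $t\in(-T,0)$ there is $\ell(t)$ with $K^{-1}\|\nabla^ku(\cdot,t)\|_{L^\infty}^{-\alpha}\le\ell(t)\le K\|\nabla^ku(\cdot,t)\|_{L^\infty}^{-\alpha}$ such that $\nabla^ku(\cdot,t)$ is $(\varepsilon,\beta,\ell(t))$-sparse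 in $L^\infty$. *)

(* Defs.v *)
From HB Require Import structures.
From mathcomp Require Import all_boot all_order all_algebra.
From mathcomp Require Import all_classical all_reals all_analysis.

Set Implicit Arguments.
Unset Strict Implicit.
Unset Printing Implicit Defensive.

Import Order.TTheory GRing.Theory Num.Theory.
Import numFieldNormedType.Exports.

Local Open Scope classical_set_scope.
Local Open Scope ring_scope.

(* Lebesgue measure on R^d: the outer measure generated by half-open boxes,
   restricted by Caratheodory to the (complete) Lebesgue sigma-algebra. *)

Definition box (R : realType) (d : nat) (c : 'rV[R]_d * 'rV[R]_d) :
    set 'rV[R]_d :=
  [set x | forall j, c.1 0 j < x 0 j <= c.2 0 j].

Definition box_vol (R : realType) (d : nat) (c : 'rV[R]_d * 'rV[R]_d) : R :=
  \prod_(j < d) Num.max 0 (c.2 0 j - c.1 0 j).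

(* Covers are countable sets of boxes rather than sequences, so that the empty
   cover is available also when d = 0, where every box has volume 1. *)
Definition box_cover (R : realType) (d : nat) (A : set 'rV[R]_d) :
    set (set ('rV[R]_d * 'rV[R]_d)) :=
  [set C | countable C /\ A `<=` \bigcup_(c in C) box c].

Definition lebesgue_outer (R : realType) (d : nat) (A : set 'rV[R]_d) : \bar R :=
  ereal_inf [set (\esum_(c in C) (box_vol c)%:E)%E | C in box_cover A].

Section lebesgue_outer_is_outer_measure.
Variables (R : realType) (d : nat).
Implicit Types (A B : set 'rV[R]_d).
Local Open Scope ereal_scope.

Lemma box_vol_ge0 (c : 'rV[R]_d * 'rV[R]_d) : (0 <= box_vol c)%R.
Proof. by apply: prodr_ge0 => j _; rewrite le_max lexx. Qed.

Let lebesgue_outer_ge0 A : 0 <= lebesgue_outer A.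
Proof.
apply: le_ereal_inf_tmp => _ [C _ <-]; apply: esum_ge0 => c _.
by rewrite lee_fin; exact: box_vol_ge0.
Qed.

Let lebesgue_outer0 : lebesgue_outer (set0 : set 'rV[R]_d) = 0.
Proof.
apply/eqP; rewrite eq_le lebesgue_outer_ge0 andbT.
apply: ereal_inf_lbound; exists set0; last by rewrite esum_set0.
by split => //; exact: countable0.
Qed.

Let le_lebesgue_outer :
  {homo @lebesgue_outer R d : A B / A `<=` B >-> A <= B}.
Proof.
move=> A B AB; apply: ereal_inf_le_tmp => _ [C [cC BC] <-].
by exists C => //; split => //; exact: subset_trans BC.
Qed.

Let lebesgue_outer_sigma_subadditive :
  sigma_subadditive (@lebesgue_outer R d).
Proof.
move=> A; have [[i Aioo]|/forallNP Aoo] :=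
    pselect (exists i, lebesgue_outer (A i) = +oo).
  rewrite (eseries_pinfty _ _ Aioo) ?leey// => n _.
  by rewrite -ltNye (lt_le_trans _ (lebesgue_outer_ge0 _)).
apply/lee_addgt0Pr => e e0.
apply: le_trans (epsilon_trick _ _ (ltW e0)); last first.
  by move=> n; exact: lebesgue_outer_ge0.
have [C PC] : {C : nat -> set ('rV[R]_d * 'rV[R]_d) & forall n,
    box_cover (A n) (C n) /\ \esum_(c in C n) (box_vol c)%:E <=
      lebesgue_outer (A n) + (e / (2 ^ n.+1)%:R)%:E}.
  apply: (@choice _ _ (fun n D => box_cover (A n) D /\
    \esum_(c in D) (box_vol c)%:E <=
      lebesgue_outer (A n) + (e / (2 ^ n.+1)%:R)%:E)) => n.
  have en : (0 < e / (2 ^ n.+1)%:R)%R by rewrite divr_gt0// ltr0n expn_gt0.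
  have /(lb_ereal_inf_adherent en) [_ [D AD <-] DA] :
      lebesgue_outer (A n) \is a fin_num.
    by rewrite ge0_fin_numE ?lebesgue_outer_ge0// ltey; exact/eqP/Aoo.
  by exists D; split => //; exact: ltW.
apply: (@le_trans _ _ (\esum_(c in \bigcup_n C n) (box_vol c)%:E)).
  apply: ereal_inf_lbound; exists (\bigcup_n C n) => //; split.
    by apply: bigcup_countable => // n _; have [[]] := PC n.
  move=> x [n _ Anx]; have [[_ /(_ _ Anx)[c Cnc cx]] _] := PC n.
  by exists c => //; exists n.
have vol0 (c : 'rV[R]_d * 'rV[R]_d) : 0 <= (box_vol c)%:E.
  by rewrite lee_fin; exact: box_vol_ge0.
rewrite seqDU_bigcup_eq nneseries_sum_bigcup//.
apply: lee_nneseries => [n _ _|n _]; first exact: esum_ge0.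
apply: le_trans (PC n).2.
rewrite [leLHS]esum_mkcond [leRHS]esum_mkcond; apply: le_esum => c _.
case: ifPn => [/set_mem cD|_]; last by case: ifP.
by rewrite ifT//; apply/mem_set/(@subset_seqDU _ C n).
Qed.

HB.instance Definition _ := isOuterMeasure.Build R 'rV[R]_d
  (@lebesgue_outer R d) lebesgue_outer0 lebesgue_outer_ge0 le_lebesgue_outer
  lebesgue_outer_sigma_subadditive.

End lebesgue_outer_is_outer_measure.

(* 'rV[R]_d with the sigma-algebra of Lebesgue measurable sets *)
Definition Rd (R : realType) (d : nat) :=
  caratheodory_type (@lebesgue_outer R d).
HB.instance Definition _ (R : realType) (d : nat) :=
  Measurable.on (Rd R d).

Definition leb (R : realType) (d : nat) : set (Rd R d) -> \bar R :=
  @lebesgue_outer R d.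
HB.instance Definition _ (R : realType) (d : nat) :=
  isMeasure.Build _ (Rd R d) R (@leb R d)
    (@caratheodory_measure0 R 'rV[R]_d (@lebesgue_outer R d))
    (@caratheodory_measure_ge0 R 'rV[R]_d (@lebesgue_outer R d))
    (@caratheodory_measure_sigma_additive R 'rV[R]_d (@lebesgue_outer R d)).

(* Euclidean norm and balls: the library norm on 'rV[R]_d is the sup norm. *)

Definition enorm (R : realType) (d : nat) (x : 'rV[R]_d) : R :=
  Num.sqrt (\sum_(j < d) x 0 j ^+ 2).

Definition eball (R : realType) (d : nat) (x0 : 'rV[R]_d) (r : R) :
    set 'rV[R]_d :=
  [set x | enorm (x - x0) < r].

(* Tensors are families of components indexed by a finite type. *)
Definition tnorm (R : realType) (I : finType) (g : {ffun I -> R}) : R :=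
  Num.sqrt (\sum_(i : I) g i ^+ 2).

(* || h ||_{L^p(D)}; the library's 'N[_]_+oo is the essential supremum. *)
Definition Lnorm_on (R : realType) (d : nat) (p : \bar R) (D : set 'rV[R]_d)
    (h : 'rV[R]_d -> R) : \bar R :=
  ('N[@leb R d]_p[(fun x : Rd R d => (h x * \1_D x)%:E)])%E.

(* d_{j1} (d_{j2} (... d_{jk} f)) *)
Fixpoint iter_partial (R : realType) (d : nat) (js : seq 'I_d)
    (f : 'rV[R]_d -> R) : 'rV[R]_d -> R :=
  if js is j :: js' then 'D_(delta_mx 0 j) (iter_partial js' f) else f.

Definition smooth (R : realType) (d : nat) (f : 'rV[R]_d -> 'rV[R]_d) : Prop :=
  forall (i : 'I_d) (js : seq 'I_d),
    let g := iter_partial js (fun x => f x 0 i) in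
    continuous g /\ forall x (j : 'I_d), derivable g x (delta_mx 0 j).

(* The component (i, (j1, .., jk)) of nabla^k f is d_{j1} .. d_{jk} f_i. *)
Definition nabla (R : realType) (d k : nat) (f : 'rV[R]_d -> 'rV[R]_d)
    (x : 'rV[R]_d) : {ffun 'I_d * k.-tuple 'I_d -> R} :=
  [ffun ij : 'I_d * k.-tuple 'I_d =>
    iter_partial ij.2 (fun y => f y 0 ij.1) x].

Definition Linfty (R : realType) (d : nat) (I : finType)
    (g : 'rV[R]_d -> {ffun I -> R}) : Prop :=
  (forall i, measurable_fun [set: Rd R d] (fun x : Rd R d => g x i)) /\
  (Lnorm_on +oo setT (fun x => tnorm (g x)) < +oo)%E.

Definition sparse (R : realType) (d : nat) (I : finType) (eps beta ell : R)
    (g : 'rV[R]_d -> {ffun I -> R}) : Prop :=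
  [/\ 0 < ell, Linfty g & exists Sigma : set (Rd R d),
    [/\ measurable Sigma,
      (Lnorm_on +oo (~` Sigma) (fun x => tnorm (g x)) <
        beta%:E * Lnorm_on +oo setT (fun x => tnorm (g x)))%E &
      (ereal_sup [set leb (Sigma `&` eball x0 ell) / leb (eball x0 ell)
                 | x0 in [set: 'rV[R]_d]] <= eps%:E)%E]].

(* The constant K is explicit so that uniformity in time can be expressed.
   When nabla^k f = 0, powR gives 0 `^ (- alpha) = 0 instead of +oo, which
   changes nothing: [sparse] holds of no such function. *)
Definition classZ (R : realType) (d : nat) (eps beta K : R) (k : nat)
    (alpha : R) (f : 'rV[R]_d -> 'rV[R]_d) : Prop :=
  let N := fine (Lnorm_on +oo setT (fun x => tnorm (nabla k f x))) in
  exists ell : R,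
    K^-1 * N `^ (- alpha) <= ell <= K * N `^ (- alpha) /\
    sparse eps beta ell (nabla k f).

Definition classZ_uniform (R : realType) (d : nat) (eps beta : R) (k : nat)
    (alpha T : R) (u : 'rV[R]_d -> R -> 'rV[R]_d) : Prop :=
  exists K : R, 1 <= K /\
    forall t, - T < t < 0 -> classZ eps beta K k alpha (u ^~ t).

(* Main.v *)
(* With tau = -t, the field u(., t) is the rescaling x |-> a F(m x) of the
   profile F = U(., s), where a = tau^(-zt) and m = tau^(-zx). All three
   conditions reduce to comparing powers of tau as tau -> 0.

   The L^2 norm of u on B_{rad 0 / m} is comparable to tau^(d zx / 2 - zt): the
   profiles are bounded, and, since they are equi-Lipschitz and somewhere in
   B_{rad 0} not small, they are bounded below on a ball of fixed radius inside
   B_{rad 0}.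

   The sup norm of nabla^k u is comparable to tau^(- p), p = zt + k zx, so the
   admissible sparseness scales are comparable to tau^(p / (k + d / 2)). By the
   decay of the profiles nabla^k u is small outside a cube of size ~ tau^zx, so
   it is sparse at every scale that is a large multiple of tau^zx. Conversely
   nabla^k u stays above beta times its sup norm on a ball of radius ~ tau^zx
   around a nearly maximal point, so it is not sparse at any scale much smaller
   than tau^zx. Hence sparseness holds iff p / (k + d / 2) <= zx, which is
   zt <= d zx / 2. *)
Require Import Defs.
From HB Require Import structures.
From mathcomp Require Import all_boot all_order all_algebra.
From mathcomp Require Import all_classical all_reals all_analysis.
From mathcomp Require Import ring lra.
From mathcomp Require Import measurable_realfun ess_sup_inf.
Import Order.TTheory GRing.Theory Num.Theory.
Import numFieldNormedType.Exports.
Local Open Scope classical_set_scope.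
Local Open Scope ring_scope.

Set Implicit Arguments.
Unset Strict Implicit.
Unset Printing Implicit Defensive.

(** * Lebesgue measure of boxes, cubes and balls *)

(** Covers are countable sets, whereas the integration below works with series. The predicate [P]
    keeps finite and empty covers within the same statement. *)
Lemma countable_enum (R : realType) (T : pointedType) (C : set T) :
  countable C -> exists P : pred nat, exists g : nat -> T,
    (forall x, C x <-> exists2 n, P n & g n = x) /\
    forall a : T -> \bar R, (forall x, 0 <= a x)%E ->
      (\esum_(x in C) a x = \sum_(0 <= n <oo | P n) a (g n))%E.
Proof.
move=> /countable_bijP[B]; rewrite card_eq_sym => /card_set_bijP[g gbij].
exists (fun n => n \in B), g; split=> [x|a a0].
  have [gfun _ gsurj] := gbij; split; last first.
    by move=> [n /set_mem Bn <-]; exact: gfun.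
  by move=> /gsurj[n Bn <-]; exists n => //; exact: mem_set.
rewrite (reindex_esum B C g a gbij) nneseries_esum//.
by congr esum; apply/seteqP; split => n /=; rewrite inE.
Qed.

(* Induction on the dimension: the boxes meeting a hyperplane x_d = s cover the
   slice of the target, and integrating over s gives the claim. *)
Lemma cover_vol (R : realType) (d : nat) (a b : nat -> R) (P : pred nat)
    (l h : nat -> nat -> R) :
  (forall x : nat -> R, (forall j, (j < d)%N -> a j < x j <= b j) ->
    exists2 n, P n & forall j, (j < d)%N -> l n j < x j <= h n j) ->
  ((\prod_(j < d) Num.max 0 (b j - a j))%:E <=
   \sum_(0 <= n <oo | P n) (\prod_(j < d) Num.max 0 (h n j - l n j))%:E)%E.
Proof.
have prod0 e (f g : nat -> R) : 0 <= \prod_(j < e) Num.max 0 (f j - g j).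
  by apply: prodr_ge0 => j _; rewrite le_max lexx.
elim: d P => [|d IH] P cov.
  (* In dimension 0 every product is 1, so it suffices that one index satisfies [P]. *)
  have [n Pn _] : exists2 n, P n & forall j, (j < 0)%N -> l n j < a j <= h n j.
    exact: cov.
  rewrite big_ord0; under eq_eseriesr do rewrite big_ord0.
  rewrite nneseries_esum; last by move=> *; rewrite lee_fin.
  by apply: esum_ge; exists [set n]; [split=> // i -> | rewrite fsbig_set1].
pose v n := \prod_(j < d) Num.max 0 (h n j - l n j).
(* [F n s] is the contribution of box [n] to the slice at height [s]: the volume [v n] of its first
   [d] sides if [s] lies in its last side, and 0 otherwise. *)
pose F n (s : measurableTypeR R) : \bar R :=
  if P n then ((v n)%:E * (\1_(`]l n d, h n d]%classic) s)%:E)%E else 0%E.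
have F0 n s : (0 <= F n s)%E.
  by rewrite /F; case: ifP => // _; rewrite lee_fin mulr_ge0// prod0.
have itvE (x y : R) : lebesgue_measure (`]x, y]%classic : set R) = (Num.max 0 (y - x))%:E.
  rewrite lebesgue_measure_itv/= lte_fin; case: ltP => xy.
    by rewrite -EFinB max_r// subr_ge0 ltW.
  by rewrite max_l// subr_le0.
have mF n : measurable_fun setT (F n).
  rewrite /F; case: (P n); last exact: measurable_cst.
  apply: measurable_funeM; apply/measurable_EFinP.
  exact: measurable_indic.
set va := \prod_(j < d) Num.max 0 (b j - a j).
have slice s : `]a d, b d]%classic s -> (va%:E <= \sum_(0 <= n <oo) F n s)%E.
  rewrite /= in_itv/= => abs.
  (* The induction hypothesis is applied to the boxes whose last side contains [s]; a point of the
     slice gets [s] as its last coordinate. *)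
  have /IH : forall x : nat -> R, (forall j, (j < d)%N -> a j < x j <= b j) ->
      exists2 n, P n && (s \in `]l n d, h n d]) &
        forall j, (j < d)%N -> l n j < x j <= h n j.
    move=> x xab; have [|n Pn Hn] := cov (fun j => if (j < d)%N then x j else s).
      move=> j; rewrite ltnS leq_eqVlt => /predU1P[->|jd]; first by rewrite ltnn.
      by rewrite jd; exact: xab.
    exists n; first by have := Hn d (ltnSn d); rewrite ltnn Pn in_itv.
    by move=> j jd; have := Hn j (leqW jd); rewrite jd.
  move=> /le_trans; apply.
  rewrite eseries_mkcond; apply: lee_nneseries => [n _ _|n _].
    by case: ifP => // _; rewrite lee_fin prod0.
  rewrite /F; case: (P n) => //=.
  case: ifPn => [sin|_]; last by rewrite lee_fin mulr_ge0// prod0.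
  by rewrite indicE mem_set//= mule1.
have mab : measurable (`]a d, b d]%classic : set R) by exact: measurable_itv.
rewrite big_ord_recr/= -/va.
apply: (@le_trans _ _ (\int[lebesgue_measure]_(s in `]a d, b d]) va%:E)%E).
  by rewrite integral_cst// EFinM -itvE.
apply: (@le_trans _ _
    (\int[lebesgue_measure]_(s in `]a d, b d]) \sum_(0 <= n <oo) F n s)%E).
  apply: ge0_le_integral => //.
  - by move=> s _; rewrite lee_fin prod0.
  - by apply: ge0_emeasurable_sum => // n _; exact: measurable_funTS.
rewrite integral_nneseries//; last by move=> n; exact: measurable_funTS.
rewrite [leRHS]eseries_mkcond; apply: lee_nneseries => n _ => [_|].
  exact: integral_ge0.
rewrite /F; case: (P n); last by rewrite integral0.
rewrite ge0_integralZl_EFin//; last exact: prod0.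
- rewrite integral_indic// big_ord_recr/= EFinM.
  apply: lee_pmul => //; rewrite ?lee_fin ?prod0//.
  rewrite -itvE; apply: le_measure; rewrite ?inE//; exact: measurableI.
- apply/measurable_EFinP; exact: measurable_indic.
Qed.

Section LebesgueMeasure.
Context {R : realType} {d : nat}.
Implicit Types (A : set 'rV[R]_d) (x y : 'rV[R]_d) (c : 'rV[R]_d * 'rV[R]_d).

Let vol0 c : (0 <= (box_vol c)%:E)%E.
Proof. by rewrite lee_fin box_vol_ge0. Qed.

Lemma lebesgue_outer_box_le c : (lebesgue_outer (box c) <= (box_vol c)%:E)%E.
Proof.
apply: ereal_inf_lbound; exists [set c].
  by split; [exact: countable1|move=> x cx; exists c].
by rewrite esum_set1// lee_fin box_vol_ge0.
Qed.

Lemma lebesgue_outer_cover A (P : pred nat) (g : nat -> 'rV[R]_d * 'rV[R]_d) :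
  (forall x, A x -> exists2 n, P n & box (g n) x) ->
  (lebesgue_outer A <= \sum_(0 <= n <oo | P n) (box_vol (g n))%:E)%E.
Proof.
move=> cov; pose F n := if P n then box (g n) else set0.
apply: (@le_trans _ _ (lebesgue_outer (\bigcup_n F n))).
  apply: le_outer_measure => x /cov[n Pn nx].
  by exists n => //; rewrite /F Pn.
apply: (le_trans (outer_measure_sigma_subadditive _ F)).
rewrite [leRHS]eseries_mkcond; apply: lee_nneseries => [n _ _|n _].
  exact: outer_measure_ge0.
rewrite /F; case: (P n); last by rewrite outer_measure0.
exact: lebesgue_outer_box_le.
Qed.

Lemma leb_box c : leb (box c) = (box_vol c)%:E.
Proof.
apply/eqP; rewrite eq_le lebesgue_outer_box_le/=.
apply: le_ereal_inf_tmp => _ [C [/(@countable_enum R)[P [g [CP sumE]]] cov] <-].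
rewrite (sumE _ vol0).
(* [e] extends a row vector by 0 to a sequence, the format of [cover_vol]. *)
pose e (v : 'rV[R]_d) (j : nat) := if insub j is Some i then v 0 i else 0.
  have eE v (i : 'I_d) : e v i = v 0 i by rewrite /e valK.
  have volE c' : box_vol c' = \prod_(j < d) Num.max 0 (e c'.2 j - e c'.1 j).
    by apply: eq_bigr => j _; rewrite !eE.
  rewrite volE; under eq_eseriesr do rewrite volE.
  apply: (@cover_vol R d (e c.1) (e c.2) P (fun n => e (g n).1) (fun n => e (g n).2)).
  move=> x xc.
  have /cov[c' /CP[n Pn <-] gx] : box c (\row_j x j).
    by move=> j; rewrite mxE -!eE; exact: xc.
  exists n => // j jd; have := gx (Ordinal jd).
  by rewrite mxE -!eE.
Qed.

Definition set_coord x (j : 'I_d) (a : R) : 'rV[R]_d :=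
  \row_i if i == j then a else x 0 i.

(** The [min] and [max] cover the case of a hyperplane that misses the box: one piece is then
    degenerate and has volume 0. *)
Lemma box_split_vol c (j : 'I_d) (a : R) :
  box_vol (c.1, set_coord c.2 j (Num.min (c.2 0 j) a)) +
  box_vol (set_coord c.1 j (Num.max (c.1 0 j) a), c.2) = box_vol c.
Proof.
rewrite /box_vol (bigD1 j)//= [X in _ + X](bigD1 j)//= [RHS](bigD1 j)//=.
rewrite !mxE eqxx.
rewrite [X in _ * X + _](eq_bigr (fun i => Num.max 0 (c.2 0 i - c.1 0 i))); last first.
  by move=> i /negbTE ij; rewrite mxE ij.
rewrite [X in _ + _ * X](eq_bigr (fun i => Num.max 0 (c.2 0 i - c.1 0 i))); last first.
  by move=> i /negbTE ij; rewrite mxE ij.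
rewrite -mulrDl; congr (_ * _).
move: (c.1 0 j) (c.2 0 j) => l h.
by rewrite /Num.max /Num.min; repeat case: ifPn => //; rewrite -?leNgt; lra.
Qed.

(** Caratheodory's criterion: cutting each box of a cover of [X] along the hyperplane gives covers
    of the two parts of [X] with the same total volume. The half-open convention makes the two
    pieces of a box fit the half-space and its complement exactly. *)
Lemma halfspace_measurable (j : 'I_d) (a : R) :
  measurable ([set x | x 0 j <= a] : set (Rd R d)).
Proof.
apply: le_caratheodory_measurable => X.
apply: le_ereal_inf_tmp => _ [C [/(@countable_enum R)[P [g [CP sumE]]] cov] <-].
rewrite (sumE _ vol0).
pose gl n := ((g n).1, set_coord (g n).2 j (Num.min ((g n).2 0 j) a)).
pose gr n := (set_coord (g n).1 j (Num.max ((g n).1 0 j) a), (g n).2).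
under eq_eseriesr do rewrite -(box_split_vol _ j a) EFinD.
rewrite nneseriesD; [|by move=> *; exact: vol0..].
apply: leeD; apply: lebesgue_outer_cover => x [/cov[c /CP[n Pn <-] gx] /= xa];
  exists n => // i; have := gx i; rewrite /= mxE; case: eqVneq => // ->.
- by move=> /andP[-> xh]; rewrite le_min xh.
- by move=> /andP[lx ->]; move/negP: xa; rewrite -ltNge gt_max lx => ->.
Qed.

Lemma box_measurable c : measurable (box c : set (Rd R d)).
Proof.
rewrite (_ : box c = \bigcap_(j in [set: 'I_d])
    (~` [set x | x 0 j <= c.1 0 j] `&` [set x | x 0 j <= c.2 0 j])).
  apply: fin_bigcap_measurable => [|j _]; first exact: finite_finset.
  by apply: measurableI; [apply: measurableC|]; exact: halfspace_measurable.
apply/seteqP; split => x cx j; have := cx j; rewrite /=.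
  by move=> /andP[lx xh] _; split => //; apply/negP; rewrite -ltNge.
by move=> []// /negP; rewrite -ltNge => -> ->.
Qed.

Definition cube x (r : R) : set 'rV[R]_d := box (x - const_mx r, x + const_mx r).

Lemma leb_cube x r : 0 <= r -> leb (cube x r) = ((2 * r) ^+ d)%:E.
Proof.
move=> r0; rewrite leb_box /box_vol /=; congr _%:E.
rewrite (eq_bigr (fun=> 2 * r)); first by rewrite prodr_const card_ord.
by move=> j _; rewrite !mxE max_r; lra.
Qed.

Lemma cube_measurable x r : measurable (cube x r : set (Rd R d)).
Proof. exact: box_measurable. Qed.

Lemma cube_nbhs x (A : set 'rV[R]_d) : nbhs x A -> exists2 r, 0 < r & cube x r `<=` A.
Proof.
move=> /nbhs_ballP[e /= e0 eA]; exists (e / 2); first by rewrite divr_gt0.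
move=> y cy; apply: eA; split => // i j; rewrite ord1 /ball/=.
have := cy j; rewrite !mxE /= ltr_norml; lra.
Qed.

(** An open set is the union of the boxes with rational corners that it contains, and these are
    countably many. *)
Lemma open_measurable_Rd A : open A -> measurable (A : set (Rd R d)).
Proof.
move=> oA.
pose rb (q : 'rV[rat]_d * 'rV[rat]_d) := box (map_mx ratr q.1 : 'rV[R]_d, map_mx ratr q.2).
rewrite (_ : A = \bigcup_q (if pselect (rb q `<=` A) then rb q else set0)).
  apply: countable_bigcupT_measurable; first exact: countableP.
  by move=> q; case: pselect => ? /=; [exact: box_measurable|exact: measurable0].
apply/seteqP; split => [x Ax|x [q _]]; last by case: pselect => // qA; exact: qA.
have [r r0 rA] : exists2 r, 0 < r & cube x r `<=` A.
  by apply: cube_nbhs; exact: open_nbhs_nbhs.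
have P1 j : exists q : rat, ratr q \in `](x 0 j - r), (x 0 j)[.
  by apply: rat_in_itvoo; lra.
have P2 j : exists q : rat, ratr q \in `](x 0 j), (x 0 j + r)[.
  by apply: rat_in_itvoo; lra.
pose q := (\row_j projT1 (cid (P1 j)), \row_j projT1 (cid (P2 j))).
exists q => //; case: pselect => [?|[]].
  move=> j; rewrite !mxE/=.
  case: cid => p /=; case: cid => q' /=; rewrite !in_itv/=; lra.
move=> y qy; apply: rA => j; have := qy j; rewrite !mxE/=.
  case: cid => p /=; case: cid => q' /=; rewrite !in_itv/=; lra.
Qed.

Lemma continuous_measurable_Rd (f : 'rV[R]_d -> R) :
  continuous f -> measurable_fun [set: Rd R d] (f : Rd R d -> R).
Proof.
move=> /continuousP cf.
apply: (measurability (@RGenOInfty.G R)).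
  exact: RGenOInfty.measurableE.
move=> _ [_ [a ->] <-]; rewrite setTI; apply: open_measurable_Rd.
by apply: cf; exact: interval_open.
Qed.

Lemma leb_nbhs_gt0 x A : nbhs x A -> (0 < leb A)%E.
Proof.
move=> /cube_nbhs[r r0 rA].
apply: (@lt_le_trans _ _ (leb (cube x r))); last exact: le_outer_measure.
by rewrite leb_cube ?ltW// lte_fin exprn_gt0// mulr_gt0.
Qed.

Lemma sqrt_sum_sqr_le (I : finType) (g : I -> R) :
  Num.sqrt (\sum_i g i ^+ 2) <= \sum_i `|g i|.
Proof.
suff [s0 le_s] : 0 <= \sum_i `|g i| /\ \sum_i g i ^+ 2 <= (\sum_i `|g i|) ^+ 2.
  by rewrite -(ger0_norm s0) -sqrtr_sqr ler_wsqrtr.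
elim/big_ind2: _ => [|a s b t [a0 sa] [b0 tb]|i _]; first by rewrite expr0n.
  by split; [lra|nra].
by rewrite normr_ge0 real_normK// num_real.
Qed.

Lemma normr_le_sqrt_sum (I : finType) (g : I -> R) i :
  `|g i| <= Num.sqrt (\sum_i g i ^+ 2).
Proof.
rewrite -sqrtr_sqr ler_wsqrtr// (bigD1 i)//= lerDl.
by apply: sumr_ge0 => j _; exact: sqr_ge0.
Qed.

Lemma sub_eball_cube x r : eball x r `<=` cube x r.
Proof.
move=> y; rewrite /eball/= => yr j; rewrite !mxE/=.
have := normr_le_sqrt_sum (fun j => (y - x) 0 j) j.
rewrite !mxE => /le_lt_trans/(_ yr); rewrite ltr_norml; lra.
Qed.

(** The Euclidean norm is at most the sum of [d] coordinates of size at most [r / (d + 1)]. Dividing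
    by [d + 1] makes the bound strict and also covers [d = 0]. *)
Lemma sub_cube_eball x r : 0 < r -> cube x (r / d.+1%:R) `<=` eball x r.
Proof.
move=> r0 y yc; apply: (le_lt_trans (sqrt_sum_sqr_le _)).
apply: (@le_lt_trans _ _ (\sum_(j < d) (r / d.+1%:R))).
  by apply: ler_sum => j _; have := yc j; rewrite !mxE/=; move: (r / _) => t; rewrite ler_norml; lra.
rewrite sumr_const card_ord -[X in X < _]mulr_natr -mulrA gtr_pMr//.
by rewrite mulrC ltr_pdivrMr ?ltr0n// mul1r ltr_nat.
Qed.

Lemma leb_eball_le x r : 0 <= r -> (leb (eball x r) <= ((2 * r) ^+ d)%:E)%E.
Proof.
by move=> r0; rewrite -(leb_cube x)//; apply: le_outer_measure; exact: sub_eball_cube.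
Qed.

Lemma leb_eball_ge x r : 0 < r ->
  (((2 * (r / d.+1%:R)) ^+ d)%:E <= leb (eball x r))%E.
Proof.
move=> r0; have t0 : 0 <= r / d.+1%:R by rewrite divr_ge0 ?ltW.
rewrite -(leb_cube x t0).
by apply: le_outer_measure; exact: sub_cube_eball.
Qed.

(** Arbitrary finite families allow one proof for both [enorm] and [tnorm]. *)
Lemma continuous_sqrt_sum (I : finType) (g : I -> 'rV[R]_d -> R) :
  (forall i, continuous (g i)) ->
  continuous (fun x => Num.sqrt (\sum_i g i x ^+ 2)).
Proof.
move=> gc x; apply: (@continuous_comp _ _ _ (fun y => \sum_i g i y ^+ 2)); last first.
  exact: sqrt_continuous.
apply: continuous_big => [|i _ {}x]; first exact: add_continuous.
by apply: (@continuous_comp _ _ _ (g i) (fun z => z ^+ 2)); [exact: gc|exact: exprn_continuous].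
Qed.

Lemma enorm_continuous : continuous (@enorm R d).
Proof. by apply: continuous_sqrt_sum => j; exact: coord_continuous. Qed.

Lemma eball_open x r : open (eball x r).
Proof.
have c : continuous (fun y => enorm (y - x)).
  move=> y; apply: continuous_comp; last exact: enorm_continuous.
  by apply: continuousB => //; exact: cst_continuous.
by move/continuousP: c => /(_ [set z | z < r]); apply; exact: open_lt.
Qed.

End LebesgueMeasure.

(** * Lebesgue norms *)

Section LpNorms.
Context {R : realType} {d : nat}.
Implicit Types (D E : set 'rV[R]_d) (h : 'rV[R]_d -> R).
Local Open Scope ereal_scope.

(** The norm of exponent [+oo] unfolds to the essential supremum only over a space of positive
    measure. *)
Let lebT_gt0 : 0 < (@leb R d) [set: Rd R d].
Proof. exact: (@leb_nbhs_gt0 _ _ (0%R : 'rV[R]_d) _ filterT). Qed.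

Lemma Lnorm_oo_leP D h (M : \bar R) : Lnorm_on +oo D h <= M <->
  {ae @leb R d, forall x, `|(h x * \1_D x)%:E| <= M}.
Proof.
rewrite /Lnorm_on unlock lebT_gt0; split; first by move/ess_supP.
by move=> hM; apply/ess_supP.
Qed.

Lemma Lnorm_oo_le D h (M : R) : (0 <= M)%R ->
  (forall x, D x -> (`|h x| <= M)%R) -> Lnorm_on +oo D h <= M%:E.
Proof.
move=> M0 hM; apply/Lnorm_oo_leP/nearW => x; rewrite abse_EFin lee_fin normrM indicE.
have [/set_mem/hM|_] := boolP (x \in D); first by rewrite normr1 mulr1.
by rewrite normr0 mulr0.
Qed.

Lemma Lnorm_oo_gt D h (m : R) : (0 <= m)%R -> m%:E < Lnorm_on +oo D h ->
  exists2 x, D x & (m < `|h x|)%R.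
Proof.
move=> m0; apply: contraPP => /forall2NP hm; apply/negP; rewrite -leNgt.
apply: Lnorm_oo_le => // x Dx.
by have [//|/negP] := hm x; rewrite -leNgt.
Qed.

(** A value above the essential supremum would, by continuity, be exceeded on a neighbourhood of
    [x], which has positive measure. This turns norm bounds into pointwise bounds. *)
Lemma le_Lnorm_oo h x : continuous h -> `|h x|%:E <= Lnorm_on +oo setT h.
Proof.
move=> hc; rewrite leNgt; apply/negP => hx.
have L0 : 0 <= Lnorm_on +oo setT h by exact: Lnorm_ge0.
have Lfin : Lnorm_on +oo setT h \is a fin_num by rewrite ge0_fin_numE// (lt_trans hx)// ltry.
have /Lnorm_oo_leP[N [mN N0 subN]] := lexx (Lnorm_on +oo setT h).
pose A := [set y | (fine (Lnorm_on +oo setT h) < `|h y|)%R].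
have : nbhs x A.
  have /continuousP/(_ [set z | (fine (Lnorm_on +oo setT h) < z)%R]) oA :
      continuous (fun y => `|h y|)%R.
    by move=> y; apply: (@continuous_comp _ _ _ h Num.norm); [exact: hc|exact: norm_continuous].
  by apply: open_nbhs_nbhs; split; [apply: oA; exact: open_gt|rewrite /A/= -lte_fin fineK].
move=> /leb_nbhs_gt0; rewrite ltNge => /negP; apply.
rewrite -[leRHS]N0; apply: le_outer_measure => y Ay; apply: subN => /=.
apply/negP; rewrite -ltNge indicE in_setT mulr1.
by rewrite -(fineK Lfin) lte_fin.
Qed.

Let measurable_indic_EFin D : measurable (D : set (Rd R d)) ->
  measurable_fun [set: Rd R d] (fun x : Rd R d => (\1_D x)%:E : \bar R).
Proof. by move=> mD; apply/measurable_EFinP; exact: measurable_indic. Qed.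

Let integral_scaled_indic D (a : R) : (0 <= a)%R -> measurable (D : set (Rd R d)) ->
  \int[@leb R d]_x (a%:E * (\1_D x)%:E) = a%:E * leb D.
Proof.
move=> a0 mD; rewrite ge0_integralZl_EFin; [|exact: measurableT| | |exact: a0].
- by rewrite integral_indic; [rewrite setIT|exact: measurableT|exact: mD].
- by move=> x _; rewrite lee_fin.
- exact: measurable_indic_EFin.
Qed.

Let measurable_sqr_restrict D h : measurable_fun [set: Rd R d] (h : Rd R d -> R) ->
  measurable (D : set (Rd R d)) ->
  measurable_fun [set: Rd R d] (fun x : Rd R d => ((h x * \1_D x) ^+ 2)%:E : \bar R).
Proof.
move=> mh mD; apply/measurable_EFinP; apply: measurable_funX.
by apply: measurable_funM => //; exact: measurable_indic.
Qed.

Lemma Lnorm2E D h : Lnorm_on 2%:E D h =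
  (\int[@leb R d]_x ((h x * \1_D x) ^+ 2)%:E) `^ 2^-1.
Proof.
rewrite /Lnorm_on unlock; congr (_ `^ _); apply: eq_integral => x _.
by rewrite abse_EFin poweR_EFin powR_mulrn// real_normK// num_real.
Qed.

Lemma Lnorm2_le D h (M V : R) : (0 <= M)%R -> (0 <= V)%R ->
  measurable_fun [set: Rd R d] (h : Rd R d -> R) ->
  measurable (D : set (Rd R d)) -> leb D <= V%:E ->
  (forall x, D x -> (`|h x| <= M)%R) ->
  Lnorm_on 2%:E D h <= (M * Num.sqrt V)%:E.
Proof.
move=> M0 V0 mh mD DV hM.
rewrite Lnorm2E.
suff le_int : \int[@leb R d]_x ((h x * \1_D x) ^+ 2)%:E <= (M ^+ 2 * V)%:E.
  apply: (le_trans (gt0_ler_poweR _ _ _ le_int)); rewrite ?invr_ge0//.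
  - by rewrite in_itv/= leey integral_ge0// => x _; rewrite lee_fin sqr_ge0.
  - by rewrite in_itv/= leey lee_fin mulr_ge0// sqr_ge0.
  by rewrite poweR_EFin powR12_sqrt ?mulr_ge0 ?sqr_ge0// sqrtrM ?sqr_ge0// sqrtr_sqr ger0_norm.
apply: (@le_trans _ _ (\int[@leb R d]_x ((M ^+ 2)%:E * (\1_(D : set (Rd R d)) x)%:E))).
  apply: ge0_le_integral.
  - exact: measurableT.
  - by move=> x _; rewrite lee_fin sqr_ge0.
  - exact: measurable_sqr_restrict.
  - by apply: measurable_funeM; exact: measurable_indic_EFin.
  move=> x _; rewrite -EFinM lee_fin indicE exprMn.
  have [/set_mem/hM hx|_] := boolP (x \in D); last by rewrite expr0n !mulr0.
  by rewrite expr1n !mulr1 -real_normK ?num_real// lerXn2r// nnegrE.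
rewrite integral_scaled_indic ?sqr_ge0// (EFinM (M ^+ 2)).
by apply: lee_wpmul2l => //; rewrite lee_fin sqr_ge0.
Qed.

Lemma Lnorm2_ge D E h (m V : R) : (0 <= m)%R -> (0 <= V)%R ->
  measurable_fun [set: Rd R d] (h : Rd R d -> R) ->
  measurable (D : set (Rd R d)) -> measurable (E : set (Rd R d)) ->
  E `<=` D -> V%:E <= leb E -> (forall x, E x -> (m <= `|h x|)%R) ->
  (m * Num.sqrt V)%:E <= Lnorm_on 2%:E D h.
Proof.
move=> m0 V0 mh mD mE ED VE hm.
rewrite Lnorm2E.
suff le_int : (m ^+ 2 * V)%:E <= \int[@leb R d]_x ((h x * \1_D x) ^+ 2)%:E.
  apply: (le_trans _ (gt0_ler_poweR _ _ _ le_int)); rewrite ?invr_ge0//.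
  - by rewrite poweR_EFin powR12_sqrt ?mulr_ge0 ?sqr_ge0// sqrtrM ?sqr_ge0// sqrtr_sqr ger0_norm.
  - by rewrite in_itv/= leey lee_fin mulr_ge0// sqr_ge0.
  by rewrite in_itv/= leey integral_ge0// => x _; rewrite lee_fin sqr_ge0.
apply: (@le_trans _ _ (\int[@leb R d]_x ((m ^+ 2)%:E * (\1_(E : set (Rd R d)) x)%:E))).
  rewrite integral_scaled_indic ?sqr_ge0// (EFinM (m ^+ 2)).
  by apply: lee_wpmul2l => //; rewrite lee_fin sqr_ge0.
apply: ge0_le_integral.
- exact: measurableT.
- by move=> x _; rewrite -EFinM lee_fin mulr_ge0 ?sqr_ge0.
- by apply: measurable_funeM; exact: measurable_indic_EFin.
- exact: measurable_sqr_restrict.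
move=> x _; rewrite -EFinM lee_fin !indicE exprMn.
have [/set_mem Ex|_] := boolP (x \in E); last by rewrite mulr0 mulr_ge0 ?sqr_ge0.
rewrite mem_set ?expr1n ?mulr1; last exact: ED.
by rewrite -[leRHS]real_normK ?num_real// lerXn2r ?nnegrE// hm.
Qed.

End LpNorms.

(** * Lipschitz bounds and rescaling of derivatives *)

(** A crude Lipschitz factor: the change of [tnorm] is summed over all components, and each
    component is moved along [d] coordinates in turn. *)
Definition nabla_lip_const (R : realType) (d k : nat) : R :=
  #|{: 'I_d * k.-tuple 'I_d}|%:R * d%:R.

Section Calculus.
Context {R : realType} {d : nat}.
Implicit Types (x y v : 'rV[R]_d) (f : 'rV[R]_d -> 'rV[R]_d) (g : 'rV[R]_d -> R).

(** Since [smooth] speaks of directional derivatives, the chain rule is obtained on difference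
    quotients, by the substitution of [m * h] for [h]. *)
Lemma is_derive_rescale g (a m : R) x v : m != 0 -> derivable g (m *: x) v ->
  is_derive x v (fun y => a * g (m *: y)) (a * m * 'D_v g (m *: x)).
Proof.
move=> m0 dg.
have m0' : (m * h @[h --> 0^']) --> 0^'.
  move=> A /=; rewrite /dnbhs /within /= => A0.
  have : nbhs (m * 0) [set z | z != 0 -> A z] by rewrite mulr0.
  move=> /(@mulrl_continuous _ m 0) /=; rewrite nbhs_filterE.
  rewrite nbhs_simpl /= => H; change (nbhs (0 : R) [set h : R | h != 0 -> A (m * h)]).
  by apply: (filterS _ H) => h hA h0; apply: hA; rewrite mulf_neq0.
pose q (h : R) := h^-1 *: ((g \o shift (m *: x)) (h *: v) - g (m *: x)).
have qD : q h @[h --> 0^'] --> 'D_v g (m *: x) by exact: dg.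
have qmD : q (m * h) @[h --> 0^'] --> 'D_v g (m *: x) by exact: (cvg_comp _ _ m0' qD).
have qE h : h^-1 *: (((fun y => a * g (m *: y)) \o shift x) (h *: v) -
    a * g (m *: x)) = a * m * q (m * h).
  rewrite /q /= (scalerDr m) scalerA; move: (g _) (g _) => z w.
  by rewrite /GRing.scale/= invfM; move: h^-1 => k; field.
have lim_eq : (fun h => h^-1 *: (((fun y => a * g (m *: y)) \o shift x) (h *: v) -
    a * g (m *: x))) @ 0^' --> a * m * 'D_v g (m *: x).
  rewrite (funext qE); apply: cvgM => //; exact: cvg_cst.
by apply: DeriveDef; [apply/cvg_ex; exists (a * m * 'D_v g (m *: x))|exact: cvg_lim lim_eq].
Qed.

Lemma is_derive_line g x v s : derivable g (s *: v + x) v ->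
  is_derive s 1 (fun r => g (r *: v + x)) ('D_v g (s *: v + x)).
Proof.
have E : (fun h : R => h^-1 *: (((fun r => g (r *: v + x)) \o shift s) (h *: 1) - g (s *: v + x)))
    = (fun h => h^-1 *: ((g \o shift (s *: v + x)) (h *: v) - g (s *: v + x))).
  by apply/funext => h /=; rewrite [h *: 1]mulr1 scalerDl addrA.
by move=> dg; apply: DeriveDef; rewrite /derivable /derive E.
Qed.

(** The mean value theorem on a segment parallel to an axis; a negative [t] is treated by exchanging
    the endpoints. *)
Lemma partial_bound_step g (j : 'I_d) (B : R) :
  (forall x, derivable g x (delta_mx 0 j)) ->
  (forall x, `|'D_(delta_mx 0 j) g x| <= B) ->
  forall x t, `|g (x + t *: delta_mx 0 j) - g x| <= B * `|t|.
Proof.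
move=> dg gB.
have pos x t : 0 <= t -> `|g (x + t *: delta_mx 0 j) - g x| <= B * t.
  move=> t0.
  have [||r _] := @MVT_segment R (fun r => g (r *: delta_mx 0 j + x))
      (fun r => 'D_(delta_mx 0 j) g (r *: delta_mx 0 j + x)) 0 t t0.
  - by move=> r _; exact: is_derive_line.
  - by apply: derivable_within_continuous => r _; have [] := is_derive_line (dg (r *: delta_mx 0 j + x)).
  rewrite scale0r add0r subr0 (addrC x) => ->.
  by rewrite normrM (ger0_norm t0) ler_wpM2r.
move=> x t; have [t0|t0] := leP 0 t; first by rewrite (ger0_norm t0) pos.
have := pos (x + t *: delta_mx 0 j) (- t); rewrite oppr_ge0 ltW// => /(_ isT).
by rewrite -addrA -scalerDl subrr scale0r addr0 distrC (ltr0_norm t0).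
Qed.

Lemma partials_bound_lipschitz g (B : R) :
  (forall x (j : 'I_d), derivable g x (delta_mx 0 j)) ->
  (forall x (j : 'I_d), `|'D_(delta_mx 0 j) g x| <= B) ->
  forall x y, `|g y - g x| <= B * \sum_j `|y 0 j - x 0 j|.
Proof.
move=> dg gB x y.
(* [z s] leads from [x] to [y] by changing one coordinate at a time. *)
pose z (s : seq 'I_d) : 'rV[R]_d := \row_j if j \in s then y 0 j else x 0 j.
have zB s : uniq s -> `|g (z s) - g x| <= B * \sum_(j <- s) `|y 0 j - x 0 j|.
  elim: s => [_|j s IH /= /andP[js us]].
    by rewrite big_nil mulr0 (_ : z _ = x) ?subrr ?normr0//; apply/rowP => i; rewrite mxE.
  have -> : z (j :: s) = z s + (y 0 j - x 0 j) *: delta_mx 0 j.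
    apply/rowP => i; rewrite !mxE inE eqxx/=.
    by have [->|] := eqVneq i j; rewrite ?(negbTE js) /= ?mulr1 ?mulr0 ?addr0// addrC subrK.
  rewrite big_cons mulrDr.
  rewrite -[X in `|X - _|](subrK (g (z s))) -addrA (le_trans (ler_normD _ _))//.
  by apply: lerD; [apply: partial_bound_step|exact: IH].
have := zB (index_enum _) (index_enum_uniq _).
by rewrite (_ : z _ = y)//; apply/rowP => i; rewrite mxE mem_index_enum.
Qed.

(** After squaring, the inequality follows termwise: with [w = g i - h i], both
    [h i * w <= tnorm h * |w|] and [w^2 <= e * |w|] hold. *)
Lemma tnorm_le_add (I : finType) (g h : {ffun I -> R}) :
  tnorm g <= tnorm h + \sum_i `|g i - h i|.
Proof.
set e := \sum_i _; have e0 : 0 <= e by exact: sumr_ge0.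
have h0 : 0 <= tnorm h by exact: sqrtr_ge0.
rewrite -(ger0_norm (addr_ge0 h0 e0)) -sqrtr_sqr ler_wsqrtr//.
apply: (@le_trans _ _ (\sum_i h i ^+ 2 + 2 * tnorm h * e + e ^+ 2)); last first.
  rewrite sqrrD -/(tnorm h) /tnorm sqr_sqrtr; last by apply: sumr_ge0 => i _; exact: sqr_ge0.
  by rewrite lerD2r lerD2l -mulrA mulr_natl.
have le_e i : `|g i - h i| <= e by rewrite /e (bigD1 i)//= lerDl sumr_ge0.
have -> : \sum_i h i ^+ 2 + 2 * tnorm h * e + e ^+ 2 =
    \sum_i (h i ^+ 2 + (2 * tnorm h + e) * `|g i - h i|).
  by rewrite big_split/= -mulr_sumr -/e; ring.
apply: ler_sum => i _.
have hi : `|h i| <= tnorm h by exact: normr_le_sqrt_sum.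
have := le_e i; move: (g i - h i) (subrK (h i) (g i)) => w <-.
move=> we.
have : h i * w <= tnorm h * `|w|.
  by rewrite (le_trans (ler_norm _))// normrM ler_wpM2r.
have : w ^+ 2 <= e * `|w| by rewrite -real_normK ?num_real// expr2 ler_wpM2r.
by nra.
Qed.

Lemma smooth_nabla_continuous f k ij : smooth f -> continuous (fun x => nabla k f x ij).
Proof.
move=> sf; rewrite (_ : (fun x => _) = iter_partial ij.2 (fun y => f y 0 ij.1)).
  by have [] := sf ij.1 ij.2.
by apply/funext => x; rewrite ffunE.
Qed.

Lemma tnorm_nabla_continuous f k : smooth f -> continuous (fun x => tnorm (nabla k f x)).
Proof. by move=> sf; apply: continuous_sqrt_sum => ij; exact: smooth_nabla_continuous. Qed.

(** The partial derivatives of the components of [nabla k f] are components of [nabla k.+1 f], hence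
    bounded by [B]. *)
Lemma nabla_lipschitz f k (B : R) : smooth f ->
  (forall x, tnorm (nabla k.+1 f x) <= B) ->
  forall x y, tnorm (nabla k f y) <= tnorm (nabla k f x) +
    nabla_lip_const R d k * B * enorm (y - x).
Proof.
rewrite /nabla_lip_const.
move=> sf fB x y; apply: (le_trans (tnorm_le_add _ (nabla k f x))).
have B0 : 0 <= B by apply: le_trans (fB x); exact: sqrtr_ge0.
rewrite lerD2l.
apply: (@le_trans _ _ (\sum_(i : 'I_d * k.-tuple 'I_d) (d%:R * B * enorm (y - x)))); last first.
  by rewrite sumr_const -[leLHS]mulr_natl !mulrA.
apply: ler_sum => -[i js] _; rewrite !ffunE/=.
apply: (@le_trans _ _ (B * \sum_j `|y 0 j - x 0 j|)).
  apply: partials_bound_lipschitz => z j; first by have [_] := sf i js; apply.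
  apply: le_trans (fB z).
  have := normr_le_sqrt_sum (nabla k.+1 f z) (i, [tuple of j :: js]).
  by rewrite ffunE.
rewrite -mulrA mulrCA ler_wpM2l//.
apply: (@le_trans _ _ (\sum_(j < d) enorm (y - x))).
  apply: ler_sum => j _; have := normr_le_sqrt_sum (fun j => (y - x) 0 j) j.
  by rewrite !mxE.
by rewrite sumr_const card_ord mulr_natl.
Qed.

Lemma nabla_rescale f k (a m : R) x : m != 0 -> smooth f ->
  nabla k (fun y => a *: f (m *: y)) x =
  [ffun ij => a * m ^+ k * nabla k f (m *: x) ij].
Proof.
move=> m0 sf; apply/ffunP => -[i js]; rewrite !ffunE/=.
have -> : (fun y => (a *: f (m *: y)) 0 i) = (fun y => a * f (m *: y) 0 i).
  by apply/funext => y; rewrite mxE.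
(* The exponent becomes the length of the list of directions, so that induction on the list applies:
   each derivative yields one factor [m]. *)
rewrite -{2}(size_tuple js); move: (tval js) => {k}{}js.
elim: js x => [|j js IH] x /=; first by rewrite mulr1.
rewrite (funext IH).
have [_ dg] := sf i js.
have [_ ->] := is_derive_rescale (a * m ^+ size js) m0 (dg (m *: x) j).
by rewrite exprSr !mulrA.
Qed.

Lemma tnormZ (I : finType) (a : R) (g : {ffun I -> R}) : 0 <= a ->
  tnorm [ffun i => a * g i] = a * tnorm g.
Proof.
move=> a0; rewrite /tnorm (eq_bigr (fun i => a ^+ 2 * g i ^+ 2)).
  by rewrite -mulr_sumr sqrtrM ?sqr_ge0// sqrtr_sqr ger0_norm.
by move=> i _; rewrite ffunE exprMn.
Qed.

Lemma tnorm_nabla0 f x : tnorm (nabla 0 f x) = enorm (f x).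
Proof.
rewrite /tnorm /enorm (reindex (fun i : 'I_d => (i, [tuple] : 0.-tuple 'I_d))).
  by congr Num.sqrt; apply: eq_bigr => i _; rewrite ffunE.
by exists fst => // -[i js] _; rewrite (tuple0 js).
Qed.

Lemma enormZ (a : R) x : 0 <= a -> enorm (a *: x) = a * enorm x.
Proof.
move=> a0; rewrite /enorm (eq_bigr (fun i => a ^+ 2 * x 0 i ^+ 2)).
  by rewrite -mulr_sumr sqrtrM ?sqr_ge0// sqrtr_sqr ger0_norm.
by move=> i _; rewrite mxE exprMn.
Qed.

End Calculus.

(** * Rescaled fields *)

Section RealPowers.
Context {R : realType}.
Implicit Types x y e : R.

Lemma powR_opp_le x y e : 0 <= e -> 0 < x -> x <= y -> y `^ (- e) <= x `^ (- e).
Proof.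
move=> e0 x0 xy; have y0 := lt_le_trans x0 xy.
rewrite !powRN lef_pV2 ?posrE ?powR_gt0//.
by apply: ge0_ler_powR => //; rewrite nnegrE ltW.
Qed.

(** If [e] were positive, the right-hand side would tend to 0 with [tau]. Both necessity claims of
    the theorem read off the sign of an exponent in this way. *)
Lemma powR_bounded_below_le0 (T e theta G : R) : 0 < T -> 0 < theta ->
  (forall tau, 0 < tau < T -> theta <= G * tau `^ e) -> e <= 0.
Proof.
move=> T0 th0 H; rewrite leNgt; apply/negP => e0.
(* [G'] is a positive majorant of [G], and [rho] is chosen so that [G' * rho] equals [theta / 2]. *)
pose G' := `|G| + 1; have G'0 : 0 < G' by rewrite ltr_wpDl.
pose rho := theta / (2 * G'); have rho0 : 0 < rho by rewrite divr_gt0// mulr_gt0.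
pose tau := Num.min (T / 2) (rho `^ e^-1).
have tau0 : 0 < tau by rewrite lt_min divr_gt0//= powR_gt0.
have tauT : tau < T by rewrite gt_min; apply/orP; left; lra.
have : tau `^ e <= rho.
  have en0 : e != 0 by rewrite gt_eqF.
  rewrite -[leRHS](powRr1 (ltW rho0)) -(mulVf en0) powRrM.
  apply: ge0_ler_powR; rewrite ?nnegrE ?powR_ge0 ?(ltW e0) ?(ltW tau0)//.
  by rewrite ge_min lexx orbT.
have := H tau; rewrite tau0 tauT => /(_ isT).
have p0 : 0 <= tau `^ e by exact: powR_ge0.
have GG : G <= G' by rewrite /G' (le_trans (ler_norm _))// lerDl.
have rE : rho * (2 * G') = theta by rewrite /rho divfK// gt_eqF// mulr_gt0.
nra.
Qed.

End RealPowers.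

Lemma enorm_triangle (R : realType) d (x y : 'rV[R]_d) :
  enorm (x + y) <= enorm x + enorm y.
Proof.
have x0 : 0 <= enorm x by exact: sqrtr_ge0.
have y0 : 0 <= enorm y by exact: sqrtr_ge0.
have sqE (z : 'rV[R]_d) : \sum_j z 0 j ^+ 2 = enorm z ^+ 2.
  by rewrite sqr_sqrtr// sumr_ge0// => j _; exact: sqr_ge0.
(* Cauchy-Schwarz: the sum of the squares of [|y| x_j - |x| y_j] equals [2 |x| |y| (|x| |y| - x.y)].
   If [|x| |y| = 0], one vector vanishes. *)
have cs : \sum_j x 0 j * y 0 j <= enorm x * enorm y.
  have : 0 <= \sum_j (enorm y * x 0 j - enorm x * y 0 j) ^+ 2.
    by apply: sumr_ge0 => j _; exact: sqr_ge0.
  have -> : \sum_j (enorm y * x 0 j - enorm x * y 0 j) ^+ 2 =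
      2 * (enorm x * enorm y) * (enorm x * enorm y - \sum_j x 0 j * y 0 j).
    under eq_bigr => j _.
      rewrite (_ : _ ^+ 2 = enorm y ^+ 2 * x 0 j ^+ 2 + enorm x ^+ 2 * y 0 j ^+ 2 +
        (- (2 * (enorm x * enorm y))) * (x 0 j * y 0 j)); last by ring.
      over.
    by rewrite !big_split/= -!mulr_sumr !sqE; ring.
  have [xy0|] := ltP 0 (enorm x * enorm y).
    have p0 : 0 < 2 * (enorm x * enorm y) by rewrite mulr_gt0.
    by rewrite (pmulr_rge0 _ p0) subr_ge0.
  move=> xy0 _; have /eqP : enorm x * enorm y = 0.
    by apply/eqP; rewrite eq_le xy0 mulr_ge0.
  have z0 (z : 'rV[R]_d) j : enorm z = 0 -> z 0 j = 0.
    move=> e; apply/eqP; rewrite -normr_le0 -e.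
    exact: (normr_le_sqrt_sum (fun j => z 0 j)).
  rewrite mulf_eq0 => /orP[]/eqP e0; rewrite e0 ?mulr0 ?mul0r big1// => j _;
    by rewrite (z0 _ _ e0) ?mulr0 ?mul0r.
rewrite -[leRHS]ger0_norm ?addr_ge0// -sqrtr_sqr ler_wsqrtr//.
rewrite (eq_bigr (fun j => x 0 j ^+ 2 + y 0 j ^+ 2 + 2 * (x 0 j * y 0 j))).
  by rewrite !big_split/= -mulr_sumr !sqE; nra.
by move=> j _; rewrite mxE; ring.
Qed.

Section RescaledField.
Context {R : realType} {d : nat}.
Variables (F : 'rV[R]_d -> 'rV[R]_d) (a m : R).
Hypotheses (sF : smooth F) (a0 : 0 < a) (m0 : 0 < m).
Let f (x : 'rV[R]_d) : 'rV[R]_d := a *: F (m *: x).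

Let mn0 : m != 0. Proof. by rewrite gt_eqF. Qed.
Let aw : 0 <= a. Proof. exact: ltW. Qed.
Let mw : 0 <= m. Proof. exact: ltW. Qed.

Lemma tnorm_nabla_rescale k x :
  tnorm (nabla k f x) = a * m ^+ k * tnorm (nabla k F (m *: x)).
Proof. by rewrite nabla_rescale// tnormZ// mulr_ge0 ?exprn_ge0 ?ltW. Qed.

Let rescale_continuous : continuous (fun x : 'rV[R]_d => m *: x).
Proof. exact: scaler_continuous. Qed.

Lemma nabla_rescale_continuous k ij : continuous (fun x => nabla k f x ij).
Proof.
have -> : (fun x => nabla k f x ij) = (fun x => a * m ^+ k * nabla k F (m *: x) ij).
  by apply/funext => x; rewrite nabla_rescale// ffunE.
move=> x; apply: (@continuousM _ _ (fun=> a * m ^+ k)); first exact: cst_continuous.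
apply: (@continuous_comp _ _ _ (fun x : 'rV[R]_d => m *: x) (fun y => nabla k F y ij)).
  exact: rescale_continuous.
exact: smooth_nabla_continuous.
Qed.

Lemma tnorm_nabla_rescale_continuous k : continuous (fun x => tnorm (nabla k f x)).
Proof. by apply: continuous_sqrt_sum => ij; exact: nabla_rescale_continuous. Qed.

Let N k := Lnorm_on +oo setT (fun x => tnorm (nabla k f x)).

Lemma Lnorm_nabla_rescale_ge k y : ((a * m ^+ k * tnorm (nabla k F y))%:E <= N k)%E.
Proof.
have := le_Lnorm_oo (m^-1 *: y) (@tnorm_nabla_rescale_continuous k).
by rewrite ger0_norm ?sqrtr_ge0// tnorm_nabla_rescale scalerA mulfV// scale1r.
Qed.

Lemma Lnorm_nabla_rescale_le k (B : R) : (forall y, tnorm (nabla k F y) <= B) ->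
  (N k <= (a * m ^+ k * B)%:E)%E.
Proof.
move=> FB; have am0 : 0 <= a * m ^+ k by rewrite mulr_ge0 ?exprn_ge0 ?ltW.
apply: Lnorm_oo_le => [|x _].
  by rewrite mulr_ge0// (le_trans _ (FB 0))// sqrtr_ge0.
by rewrite ger0_norm ?sqrtr_ge0// tnorm_nabla_rescale ler_wpM2l.
Qed.

(** The set [Sigma] is the cube of half-side [M / m], outside which the rescaled profile is at most
    half of the allowed level; the half makes the inequality strict. *)
Lemma rescale_sparse k (B c M eps beta ell : R) y0 :
  (0 < d)%N -> 0 < c -> 0 < M -> 0 < eps < 1 -> 0 < beta ->
  (forall y, tnorm (nabla k F y) <= B) -> c <= tnorm (nabla k F y0) ->
  (forall y, M <= enorm y -> tnorm (nabla k F y) <= beta * c / 2) ->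
  M * d.+1%:R / (eps * m) <= ell -> sparse eps beta ell (nabla k f).
Proof.
move=> d0 c0 M0 /andP[e0 e1] b0 FB Fy0 FM ellM.
have am0 : 0 < a * m ^+ k by rewrite mulr_gt0 ?exprn_gt0.
have l0 : 0 < ell.
  by apply: lt_le_trans ellM; rewrite divr_gt0 ?mulr_gt0 ?ltr0n.
have Nge : ((a * m ^+ k * c)%:E <= N k)%E.
  by apply: le_trans (Lnorm_nabla_rescale_ge k y0); rewrite lee_fin ler_wpM2l// ltW.
split; first exact: l0.
  split; last by apply: le_lt_trans (Lnorm_nabla_rescale_le FB) _; exact: ltry.
  by move=> ij; apply: continuous_measurable_Rd; exact: nabla_rescale_continuous.
exists (cube 0 (M / m)); split; first exact: cube_measurable.
  apply: (@le_lt_trans _ _ ((a * m ^+ k * (beta * c / 2))%:E)).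
    apply: Lnorm_oo_le => [|x Sx]; first by rewrite !mulr_ge0 ?exprn_ge0 ?ltW.
    rewrite ger0_norm ?sqrtr_ge0// tnorm_nabla_rescale ler_pM2l//.
    apply: FM; rewrite enormZ// -ler_pdivrMl// mulrC leNgt.
    by apply/negP => xM; apply: Sx; apply: sub_eball_cube; rewrite /eball/= subr0.
  apply: (@lt_le_trans _ _ (beta%:E * (a * m ^+ k * c)%:E)%E).
    rewrite -EFinM lte_fin; move: (a * m ^+ k) am0 => p p0.
    have : 0 < p * c * beta by rewrite mulr_gt0// mulr_gt0.
    lra.
  by apply: lee_wpmul2l => //; rewrite lee_fin ltW.
apply: ge_ereal_sup => _ [x0 _ <-].
have B1 := leb_eball_ge x0 l0; have B2 := leb_eball_le x0 (ltW l0).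
set lb := leb (eball x0 ell) in B1 B2 *.
have lbfin : lb \is a fin_num by rewrite ge0_fin_numE ?(le_lt_trans B2) ?ltry// measure_ge0.
have t0 : 0 < 2 * (ell / d.+1%:R) by rewrite mulr_gt0// divr_gt0 ?ltr0n.
have lb0 : 0 < fine lb.
  by rewrite -lte_fin fineK// (lt_le_trans _ B1)// lte_fin exprn_gt0.
rewrite -(fineK lbfin) inver gt_eqF// lee_pdivrMr// fineK//.
apply: (@le_trans _ _ (leb (cube (0 : 'rV[R]_d) (M / m)))).
  by apply: le_outer_measure => x [].
rewrite leb_cube; last by rewrite divr_ge0// ltW.
apply: (@le_trans _ _ (eps%:E * ((2 * (ell / d.+1%:R)) ^+ d)%:E)%E); last first.
  by apply: lee_wpmul2l => //; rewrite lee_fin ltW.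
rewrite -EFinM lee_fin.
(* The cube has side at most [eps] times that of a cube inside the ball of radius [ell], so the
   density is at most [eps ^+ d], which is at most [eps] because [d > 0]. *)
apply: (@le_trans _ _ ((eps * (2 * (ell / d.+1%:R))) ^+ d)).
  have Mm0 : 0 <= M / m by rewrite divr_ge0// ltW.
  have le_side : 2 * (M / m) <= eps * (2 * (ell / d.+1%:R)).
    move: ellM; rewrite ler_pdivrMr ?mulr_gt0// => ellM.
    rewrite [leRHS]mulrCA ler_pM2l// mulrA ler_pdivlMr ?ltr0n// mulrAC ler_pdivrMr//.
    by rewrite (_ : eps * ell * m = ell * (eps * m)); [exact: ellM|ring].
  have le0 : 0 <= 2 * (M / m) by rewrite mulr_ge0.
  by rewrite lerXn2r ?nnegrE// (le_trans le0).
rewrite exprMn ler_pM2r ?exprn_gt0//.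
by rewrite -[leRHS]expr1 ler_wiXn2l ?ltW.
Qed.

(** If the inequality failed, the Lipschitz bound would keep the derivative above [beta] times its
    norm on a whole ball of radius [ell]. That ball would lie in [Sigma] up to a null set, with
    density 1 instead of at most [eps < 1]. *)
Lemma sparse_rescale_scale k (c B1 eps beta ell : R) y0 :
  0 < c -> eps < 1 -> 0 < beta < 1 -> c <= tnorm (nabla k F y0) ->
  (forall y, tnorm (nabla k.+1 F y) <= B1) ->
  sparse eps beta ell (nabla k f) ->
  (1 - beta) / 2 * c <= nabla_lip_const R d k * B1 * (m * ell).
Proof.
move=> c0 e1 /andP[b0 b1] Fy0 FB1 [l0 [_ Nfin] [Sigma [mS SN Sl]]].
rewrite leNgt; apply/negP => small.
have am0 : 0 < a * m ^+ k by rewrite mulr_gt0 ?exprn_gt0.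
have Nge : ((a * m ^+ k * c)%:E <= N k)%E.
  by apply: le_trans (Lnorm_nabla_rescale_ge k y0); rewrite lee_fin ler_wpM2l// ltW.
have Nf : N k \is a fin_num by rewrite ge0_fin_numE// Lnorm_ge0.
set n := fine (N k); have nE : N k = n%:E by rewrite fineK.
have n0 : a * m ^+ k * c <= n by rewrite -lee_fin -nE.
have ngt0 : 0 < n by apply: lt_le_trans n0; rewrite mulr_gt0.
(* The level is midway between [beta * n] and [n], which leaves room for a loss of
   [(1 - beta) / 2 * n] over the ball. *)
have [x0 _ x0n] : exists2 x0, setT x0 & (1 + beta) / 2 * n < `|tnorm (nabla k f x0)|.
  apply: Lnorm_oo_gt; first by rewrite mulr_ge0 ?(ltW ngt0)//; lra.
  by rewrite -/(N k) nE lte_fin; nra.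
rewrite ger0_norm ?sqrtr_ge0// in x0n.
have big x : eball x0 ell x -> beta * n < tnorm (nabla k f x).
  move=> xl; have L0 : 0 <= nabla_lip_const R d k * B1.
    rewrite mulr_ge0 ?mulr_ge0 ?ler0n//.
    by apply: le_trans (FB1 0); exact: sqrtr_ge0.
  have := nabla_lipschitz sF FB1 (m *: x) (m *: x0).
  rewrite -scalerBr enormZ//.
  have -> : enorm (x0 - x) = enorm (x - x0).
    by rewrite /enorm; congr Num.sqrt; apply: eq_bigr => j _; rewrite !mxE -sqrrN opprB.
  have : nabla_lip_const R d k * B1 * (m * enorm (x - x0)) <=
      nabla_lip_const R d k * B1 * (m * ell).
    by apply: ler_wpM2l => //; rewrite ler_pM2l// ltW.
  move: x0n; rewrite !tnorm_nabla_rescale.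
  move: (tnorm _) (tnorm _) (nabla_lip_const R d k * B1 * (m * ell)) small => q p r small.
  move: (nabla_lip_const R d k * B1 * _) => r' h1 h2 h3.
  have h4 : p < q + (1 - beta) / 2 * c by lra.
  have : a * m ^+ k * p < a * m ^+ k * (q + (1 - beta) / 2 * c) by rewrite ltr_pM2l.
  move: (a * m ^+ k) am0 n0 h1 => s s0 n0 h1.
  by nra.
(* [Z] is a null set containing the points where the essential bound on the complement of [Sigma]
   fails. *)
have /Lnorm_oo_leP[Z [mZ Z0 subZ]] := lexx (Lnorm_on +oo (~` Sigma) (fun x => tnorm (nabla k f x))).
have sub : eball x0 ell `<=` (Sigma `&` eball x0 ell) `|` Z.
  move=> x xl; have [Sx|Sx] := pselect (Sigma x); first by left.
  right; apply: subZ => /=; apply/negP; rewrite -ltNge indicE mem_set// mulr1.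
  rewrite ger0_norm ?sqrtr_ge0//; apply: lt_trans SN _.
  by rewrite -/(N k) nE -EFinM lte_fin big.
have B1' := leb_eball_ge x0 l0; have B2' := leb_eball_le x0 (ltW l0).
have : (leb (Sigma `&` eball x0 ell) / leb (eball x0 ell) <= eps%:E)%E.
  by apply: le_trans Sl; apply: ereal_sup_ubound; exists x0.
have lbS : (leb (eball x0 ell) <= leb (Sigma `&` eball x0 ell))%E.
  have Z0' : lebesgue_outer Z = 0%E by exact: Z0.
  have : (lebesgue_outer (Sigma `&` eball x0 ell `|` Z) <=
      lebesgue_outer (Sigma `&` eball x0 ell) + lebesgue_outer Z)%E.
    exact: outer_measureU2.
  rewrite Z0' adde0.
  by apply: le_trans; exact: (le_outer_measure (@lebesgue_outer R d)).
set lb := leb (eball x0 ell) in B1' B2' lbS *.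
have lbfin : lb \is a fin_num by rewrite ge0_fin_numE ?(le_lt_trans B2') ?ltry// measure_ge0.
have lb0 : 0 < fine lb.
  rewrite -lte_fin fineK// (lt_le_trans _ B1')// lte_fin exprn_gt0//.
  by rewrite mulr_gt0// divr_gt0 ?ltr0n.
rewrite -(fineK lbfin) inver gt_eqF// lee_pdivrMr//.
apply/negP; rewrite -ltNge; apply: lt_le_trans lbS.
by rewrite -[X in (_ < X)%E](fineK lbfin) -EFinM lte_fin gtr_pMl.
Qed.

Let enorm_f_measurable :
  measurable_fun [set: Rd R d] ((fun x => enorm (f x)) : Rd R d -> R).
Proof.
apply: continuous_measurable_Rd.
rewrite (_ : (fun x => enorm (f x)) = (fun x => tnorm (nabla 0 f x))).
  exact: tnorm_nabla_rescale_continuous.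
by apply/funext => x; rewrite tnorm_nabla0.
Qed.

Lemma Lnorm2_rescale_le (B r : R) : 0 <= r -> (forall y, enorm (F y) <= B) ->
  (Lnorm_on 2%:E (eball 0 (m^-1 * r)) (fun x => enorm (f x)) <=
   (a * B * Num.sqrt ((2 * (m^-1 * r)) ^+ d))%:E)%E.
Proof.
move=> r0 FB; have B0 : 0 <= B by apply: le_trans (FB 0); exact: sqrtr_ge0.
have mr0 : 0 <= m^-1 * r by rewrite mulr_ge0// invr_ge0 ltW.
apply: Lnorm2_le.
- by rewrite mulr_ge0// ltW.
- by rewrite exprn_ge0// mulr_ge0.
- exact: enorm_f_measurable.
- exact: open_measurable_Rd (@eball_open _ _ _ _).
- exact: leb_eball_le.
- by move=> x _; rewrite ger0_norm ?sqrtr_ge0// enormZ// ler_wpM2l// ltW.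
Qed.

(* The smaller ball used below has radius delta / 2 and center a point of the
   segment from 0 to y0, so that it lies in both B_r and B_delta(y0). *)
Lemma Lnorm2_rescale_ge (r c B1 delta : R) y0 : 0 < c -> 0 < delta <= r ->
  enorm y0 < r -> c <= enorm (F y0) -> (forall y, tnorm (nabla 1 F y) <= B1) ->
  nabla_lip_const R d 0 * B1 * delta <= c / 2 ->
  ((a * (c / 2) * Num.sqrt ((2 * (m^-1 * (delta / 2) / d.+1%:R)) ^+ d))%:E <=
   Lnorm_on 2%:E (eball 0%R (m^-1 * r)) (fun x => enorm (f x)))%E.
Proof.
move=> c0 /andP[dl0 dlr] y0r Fy0 FB1 small.
have r0 : 0 < r by lra.
(* Since [|y0| < r], this factor gives [|z0| <= r - delta / 2] and [|y0 - z0| <= delta / 2]. *)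
pose z0 := (1 - delta / (2 * r)) *: y0.
have q0 : 0 <= delta / (2 * r) <= 1 / 2.
  apply/andP; split; first by rewrite divr_ge0 ?mulr_ge0 ?(ltW dl0) ?(ltW r0).
  by rewrite ler_pdivrMr ?mulr_gt0//; lra.
have y00 : 0 <= enorm y0 by exact: sqrtr_ge0.
have qr : delta / (2 * r) * r = delta / 2 by field; rewrite gt_eqF.
have md0 : 0 < m^-1 * (delta / 2) by rewrite mulr_gt0 ?invr_gt0// divr_gt0.
have zE x : eball (m^-1 *: z0) (m^-1 * (delta / 2)) x -> enorm (m *: x - z0) < delta / 2.
  rewrite /eball/= => xz.
  rewrite (_ : m *: x - z0 = m *: (x - m^-1 *: z0)).
    by rewrite enormZ// -ltr_pdivlMl.
  by rewrite scalerBr scalerA mulfV// scale1r.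
have sub0 x : eball (m^-1 *: z0) (m^-1 * (delta / 2)) x -> enorm (m *: x) < r.
  move=> /zE xz; rewrite -(subrK z0 (m *: x)).
  apply: (le_lt_trans (enorm_triangle _ _)); rewrite {2}/z0 enormZ; last lra.
  nra.
have suby x : eball (m^-1 *: z0) (m^-1 * (delta / 2)) x -> enorm (y0 - m *: x) <= delta.
  move=> /zE xz.
  have -> : y0 - m *: x = (- 1) *: (m *: x - z0) + (delta / (2 * r)) *: y0.
    rewrite /z0 scaleN1r opprB scalerBl scale1r.
    by rewrite addrAC subrK.
  apply: (le_trans (enorm_triangle _ _)); rewrite [X in _ + X]enormZ; last lra.
  have -> : enorm (-1 *: (m *: x - z0)) = enorm (m *: x - z0).
    by rewrite /enorm; congr Num.sqrt; apply: eq_bigr => j _; rewrite [in LHS]mxE mulN1r sqrrN.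
  nra.
apply: (@Lnorm2_ge _ _ _ (eball (m^-1 *: z0) (m^-1 * (delta / 2)))).
- by rewrite mulr_ge0 ?divr_ge0 ?ltW.
- by rewrite exprn_ge0// mulr_ge0 ?divr_ge0 ?ltW.
- exact: enorm_f_measurable.
- exact: open_measurable_Rd (@eball_open _ _ _ _).
- exact: open_measurable_Rd (@eball_open _ _ _ _).
- move=> x /sub0; rewrite /eball/= subr0 enormZ//.
  by rewrite -ltr_pdivlMl.
- exact: leb_eball_ge.
- move=> x /suby xd; rewrite ger0_norm ?sqrtr_ge0// enormZ//.
  rewrite ler_pM2l//.
  have L0 : 0 <= nabla_lip_const R d 0 * B1.
    rewrite mulr_ge0 ?mulr_ge0 ?ler0n//.
    by apply: le_trans (FB1 0); exact: sqrtr_ge0.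
  (* Within distance [delta] of [y0] the profile loses at most [c / 2]. *)
  have := nabla_lipschitz sF FB1 (m *: x) y0.
  rewrite !tnorm_nabla0.
  have := ler_wpM2l L0 xd; lra.
Qed.

End RescaledField.

(** * Powers of [tau] and the equivalence *)

Lemma sqrt_cube_vol (R : realType) (d : nat) (tau z q : R) : 0 < tau -> 0 <= q ->
  Num.sqrt ((2 * (tau `^ z * q)) ^+ d) =
  Num.sqrt ((2 * q) ^+ d) * tau `^ (d%:R * z / 2).
Proof.
move=> t0 q0; rewrite mulrCA exprMn sqrtrM ?exprn_ge0 ?powR_ge0// mulrC; congr (_ * _).
rewrite -powR_mulrn ?powR_ge0// -powR12_sqrt ?powR_ge0// -!powRrM.
by rewrite (mulrC d%:R z) mulrA.
Qed.

Lemma powR_mulD (R : realType) (tau x y : R) : 0 < tau ->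
  tau `^ x * tau `^ y = tau `^ (x + y).
Proof. by move=> t0; rewrite powRD// (gt_eqF t0) implybT. Qed.

Unset Implicit Arguments.
Set Strict Implicit.
Set Printing Implicit Defensive.

Theorem proposition4p1 (R : realType) (d : nat) (hd : (2 <= d)%N)
    (T zt zx S : R) (hT : 0 < T) (hzt : 0 < zt) (hzx : 0 < zx)
    (hS : S = - ln T)
    (u : 'rV[R]_d -> R -> 'rV[R]_d) (U : 'rV[R]_d -> R -> 'rV[R]_d)
    (hu : forall (x : 'rV[R]_d) (t : R), - T < t < 0 ->
      u x t = ((- t) `^ zt)^-1 *: U (((- t) `^ zx)^-1 *: x) (- ln (- t)))
    (hsmooth : forall s : R, S < s -> smooth (U ^~ s))
    (C c rad : nat -> R)
    (hpos : forall k, [/\ 0 < C k, 0 < c k & 0 < rad k])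
    (hC : forall k,
      (ereal_sup [set Lnorm_on +oo setT (fun y => tnorm (nabla k (U ^~ s) y))
                 | s in `]S, +oo[] <= (C k)%:E)%E)
    (hdecay : forall k (eta : R), 0 < eta -> exists M : R, forall y : 'rV[R]_d, M < enorm y ->
      (ereal_sup [set (tnorm (nabla k (U ^~ s) y))%:E
                 | s in `]S, +oo[] < eta%:E)%E)
    (hc : forall k,
      ((c k)%:E <=
       ereal_inf [set Lnorm_on +oo (eball 0 (rad k))
                        (fun y => tnorm (nabla k (U ^~ s) y))
                 | s in `]S, +oo[])%E)
    (eps beta : R) (heps : 0 < eps < 1) (hbeta : 0 < beta < 1)
    (k : nat) :
  [<-> (ereal_sup [set Lnorm_on 2%:E (eball 0 ((- t) `^ zx * rad 0%N))
                         (fun x => enorm (u x t))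
                  | t in `](- T)%R, 0%R[] < +oo)%E;
       classZ_uniform eps beta k (k%:R + d%:R / 2)^-1 T u;
       zt <= d%:R * zx / 2].
Proof.
have C0 j : 0 < C j by have [] := hpos j.
have c0 j : 0 < c j by have [] := hpos j.
have r0 j : 0 < rad j by have [] := hpos j.
have UC j s : S < s -> forall y, tnorm (nabla j (U ^~ s) y) <= C j.
  move=> Ss y; rewrite -lee_fin; apply: le_trans (hC j).
  apply: (@le_trans _ _ (Lnorm_on +oo setT (fun y => tnorm (nabla j (U ^~ s) y)))).
    have := le_Lnorm_oo y (tnorm_nabla_continuous (k := j) (hsmooth _ Ss)).
    by rewrite ger0_norm ?sqrtr_ge0.
  by apply: ereal_sup_ubound; exists s => //=; rewrite in_itv/= Ss.
(* Halving [c j] puts it strictly below the essential supremum, so it is exceeded at some point of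
   the ball. *)
have Uc j s : S < s -> exists2 y, enorm y < rad j & c j / 2 <= tnorm (nabla j (U ^~ s) y).
  move=> Ss; have : ((c j / 2)%:E < Lnorm_on +oo (eball 0%R (rad j))
      (fun y => tnorm (nabla j (U ^~ s) y)))%E.
    apply: (@lt_le_trans _ _ (c j)%:E); first by rewrite lte_fin; have := c0 j; lra.
    apply: le_trans (hc j) _; apply: ereal_inf_lbound.
    by exists s => //=; rewrite in_itv/= Ss.
  move=> /Lnorm_oo_gt[|y]; first by rewrite divr_ge0// ltW.
  rewrite /eball/= subr0 ger0_norm ?sqrtr_ge0// => yr /ltW cy.
  by exists y.
have Ud j eta : 0 < eta -> exists2 M, 0 < M & forall s, S < s ->
    forall y, M <= enorm y -> tnorm (nabla j (U ^~ s) y) <= eta.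
  move=> /(hdecay j)[M HM]; exists (`|M| + 1); first by rewrite ltr_wpDl.
  move=> s Ss y yM; rewrite -lee_fin; apply/ltW.
  apply: (le_lt_trans _ (HM y _)).
    by apply: ereal_sup_ubound; exists s => //=; rewrite in_itv/= Ss.
  by rewrite (lt_le_trans _ yM)// (le_lt_trans (ler_norm M))// ltrDl.
have sS tau : 0 < tau < T -> S < - ln tau.
  by move=> /andP[t0 tT]; rewrite hS ltrN2 ltr_ln ?posrE.
have tS t : - T < t < 0 -> 0 < - t < T by lra.
have uE t : - T < t < 0 -> u ^~ t =
    fun x => ((- t) `^ zt)^-1 *: (U ^~ (- ln (- t))) (((- t) `^ zx)^-1 *: x).
  by move=> tT; apply/funext => x; exact: hu.
have euE t : - T < t < 0 -> (fun x => enorm (u x t)) =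
    fun x => enorm (((- t) `^ zt)^-1 *: (U ^~ (- ln (- t))) (((- t) `^ zx)^-1 *: x)).
  by move=> tT; apply/funext => x; rewrite hu.
pose L j : R := nabla_lip_const R d j.
have L0 j : 0 <= L j * C j.+1 by rewrite mulr_ge0 ?(ltW (C0 _))// mulr_ge0.
have h13 : (ereal_sup [set Lnorm_on 2%:E (eball 0 ((- t) `^ zx * rad 0%N))
      (fun x => enorm (u x t)) | t in `](- T)%R, 0%R[] < +oo)%E ->
    zt <= d%:R * zx / 2.
  set sup := ereal_sup _ => supoo.
  (* A radius independent of [t], over which the profile, at least [c 0 / 2] at some point, loses at
     most half of that. The added 1 keeps the denominator positive. *)
  pose delta := Num.min (rad 0) (c 0 / 4 / (L 0 * C 1 + 1)).
  have LC1 : 0 < L 0 * C 1 + 1 by rewrite ltr_wpDl// L0.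
  have dl0 : 0 < delta by rewrite lt_min r0 !divr_gt0.
  pose q := delta / 2 / d.+1%:R.
  have q0 : 0 < q by rewrite !divr_gt0// ltr0n.
  pose th := c 0 / 2 / 2 * Num.sqrt ((2 * q) ^+ d).
  have th0 : 0 < th by rewrite mulr_gt0 ?divr_gt0// sqrtr_gt0 exprn_gt0// mulr_gt0.
  have low t : - T < t < 0 -> ((th * (- t) `^ (d%:R * zx / 2 - zt))%:E <= sup)%E.
    move=> tT; have /andP[t0 _] := tS _ tT; have Ss := sS _ (tS _ tT).
    have [y0 yr cy] := Uc 0 _ Ss.
    apply: (@le_trans _ _ (Lnorm_on 2%:E (eball 0 ((- t) `^ zx * rad 0%N))
        (fun x => enorm (u x t)))); last first.
      by apply: ereal_sup_ubound; exists t => //=; rewrite in_itv.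
    have a0 : 0 < ((- t) `^ zt)^-1 by rewrite invr_gt0 powR_gt0.
    have m0 : 0 < ((- t) `^ zx)^-1 by rewrite invr_gt0 powR_gt0.
    rewrite tnorm_nabla0 in cy.
    have small : L 0 * C 1 * delta <= c 0 / 2 / 2.
      have : delta <= c 0 / 4 / (L 0 * C 1 + 1) by rewrite ge_min lexx orbT.
      rewrite ler_pdivlMr// => h; have := L0 0; nra.
    have dr : 0 < delta <= rad 0 by rewrite dl0 ge_min lexx.
    have := Lnorm2_rescale_ge (hsmooth _ Ss) a0 m0 (divr_gt0 (c0 0) (ltr0n _ 2))
      dr yr cy (UC 1 _ Ss) small.
    rewrite invrK euE//.
    apply: le_trans; rewrite lee_fin.
    rewrite -(mulrA (_ `^ zx) (delta / 2)) sqrt_cube_vol// ?(ltW q0)// -powRN -powR_mulD//.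
    by rewrite /th; move: (_ `^ _) (_ `^ _) (Num.sqrt _) => x y z; rewrite le_eqVlt; apply/orP; left; apply/eqP; ring.
  have supf : sup \is a fin_num.
    rewrite ge0_fin_numE//; apply: le_trans (low (- T / 2) _); last lra.
    by rewrite lee_fin mulr_ge0 ?powR_ge0// ltW.
  (* Multiplying the lower bound [low] by the inverse power of [tau] bounds the positive constant
     [th] by [fine sup * tau^(zt - d zx / 2)]. *)
  have ztd : zt - d%:R * zx / 2 <= 0.
    apply: (powR_bounded_below_le0 (G := fine sup) hT th0) => tau /andP[t0 tT].
    have nT : - T < - tau < 0 by lra.
    have := low _ nT; rewrite opprK.
    rewrite -(fineK supf) lee_fin -(ler_pM2r (powR_gt0 (zt - d%:R * zx / 2) t0)).
    by rewrite -(mulrA th) powR_mulD// (_ : _ - _ + _ = 0) ?powRr0 ?mulr1//; ring.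
  lra.
have h31 : zt <= d%:R * zx / 2 ->
    (ereal_sup [set Lnorm_on 2%:E (eball 0 ((- t) `^ zx * rad 0%N))
      (fun x => enorm (u x t)) | t in `](- T)%R, 0%R[] < +oo)%E.
  move=> zz; pose V := C 0 * Num.sqrt ((2 * rad 0) ^+ d).
  have V0 : 0 <= V by rewrite mulr_ge0 ?sqrtr_ge0// ltW.
  apply: (@le_lt_trans _ _ (V * T `^ (d%:R * zx / 2 - zt))%:E); last exact: ltry.
  apply: ge_ereal_sup => _ [t + <-]; rewrite /= in_itv/= => tT.
  have /andP[t0 tT'] := tS _ tT; have Ss := sS _ (tS _ tT).
  have a0 : 0 < ((- t) `^ zt)^-1 by rewrite invr_gt0 powR_gt0.
  have m0 : 0 < ((- t) `^ zx)^-1 by rewrite invr_gt0 powR_gt0.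
  have UC0 y : enorm (U y (- ln (- t))) <= C 0.
    by have := UC 0 _ Ss y; rewrite tnorm_nabla0.
  have := Lnorm2_rescale_le (hsmooth _ Ss) a0 m0 (ltW (r0 0)) UC0.
  rewrite invrK euE//.
  move=> /le_trans; apply; rewrite lee_fin.
  rewrite sqrt_cube_vol// ?(ltW (r0 0))// -powRN.
  (* The exponent is nonnegative, so the power is largest at the end [T] of the range of [-t]. *)
  apply: (@le_trans _ _ (V * (- t) `^ (d%:R * zx / 2 - zt))).
    rewrite -powR_mulD// /V; move: (_ `^ _) (_ `^ _) (Num.sqrt _) => x y z.
    by rewrite le_eqVlt; apply/orP; left; apply/eqP; ring.
  apply: ler_wpM2l => //; apply: ge0_ler_powR; rewrite ?nnegrE ?(ltW t0) ?(ltW hT) ?(ltW tT')//.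
  lra.
pose p := zt + zx * k%:R.
pose al := (k%:R + d%:R / 2 : R)^-1.
have kd0 : 0 < (k%:R + d%:R / 2 : R).
  by rewrite ltr_wpDl// divr_gt0// ltr0n; apply: leq_trans hd.
have al0 : 0 < al by rewrite invr_gt0.
(* Condition 3 says that the sparseness scale [tau^(p al)] dominates [tau^zx]: indeed
   [zt + k zx <= zx (k + d / 2)]. *)
have zE : (zt <= d%:R * zx / 2) = (p * al - zx <= 0).
  rewrite subr_le0 /al ler_pdivrMr// /p; apply/idP/idP; lra.
have amE tau : 0 < tau -> (tau `^ zt)^-1 * ((tau `^ zx)^-1) ^+ k = tau `^ (- p).
  move=> t0; rewrite exprVn -powR_mulrn ?powR_ge0// -powRrM -!powRN powR_mulD//.
  by rewrite /p opprD.
have Nbounds t : - T < t < 0 -> exists2 n, fine (Lnorm_on +oo setT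
      (fun x => tnorm (nabla k (u ^~ t) x))) = n &
    (c k / 2) * (- t) `^ (- p) <= n <= C k * (- t) `^ (- p).
  move=> tT; have /andP[t0 tT'] := tS _ tT; have Ss := sS _ (tS _ tT).
  have a0 : 0 < ((- t) `^ zt)^-1 by rewrite invr_gt0 powR_gt0.
  have m0 : 0 < ((- t) `^ zx)^-1 by rewrite invr_gt0 powR_gt0.
  have [y0 _ cy] := Uc k _ Ss.
  have Nge := Lnorm_nabla_rescale_ge (hsmooth _ Ss) a0 m0 k y0.
  have Nle := Lnorm_nabla_rescale_le (hsmooth _ Ss) a0 m0 (UC k _ Ss).
  rewrite (uE _ tT); set N := Lnorm_on _ _ _ in Nge Nle *.
  exists (fine N) => //.
  have Nf : N \is a fin_num by rewrite ge0_fin_numE ?(le_lt_trans Nle) ?ltry// Lnorm_ge0.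
  rewrite -(fineK Nf) !lee_fin amE// in Nge Nle.
  rewrite (mulrC (C k)) Nle andbT (le_trans _ Nge)// mulrC.
  by rewrite ler_pM2l// powR_gt0.
have powal tau q : 0 < tau -> 0 < q ->
    (q * tau `^ (- p)) `^ (- al) = q `^ (- al) * tau `^ (p * al).
  move=> t0 q0; rewrite powRM ?powR_ge0 ?(ltW q0)// -powRrM.
  by rewrite mulrNN.
have h32 : zt <= d%:R * zx / 2 -> classZ_uniform eps beta k al T u.
  rewrite zE => pal.
  have /andP[e0 e1] := heps; have /andP[b0 b1] := hbeta.
  have eta0 : 0 < beta * (c k / 2) / 2 by rewrite divr_gt0// mulr_gt0// divr_gt0.
  have [M M0 HM] := Ud k _ eta0.
  pose G := M * d.+1%:R / eps.
  have G0 : 0 < G by rewrite divr_gt0// mulr_gt0// ltr0n.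
  (* [rescale_sparse] asks for a scale of at least [G (-t)^zx]. As [n <= C_k (-t)^(-p)], the largest
     admissible scale [K n^(-al)] reaches it once [K >= G C_k^al (-t)^(zx - p al)], and this last
     power is at most [T^(zx - p al)]. *)
  pose K := Num.max 1 (G * C k `^ al * T `^ (zx - p * al)).
  exists K; split; first by rewrite le_max lexx.
  have K0 : 0 < K by rewrite lt_max ltr01.
  move=> t tT; have /andP[t0 tT'] := tS _ tT; have Ss := sS _ (tS _ tT).
  have [n nE /andP[nge nle]] := Nbounds _ tT.
  rewrite /classZ nE; exists (K * n `^ (- al)); split.
    rewrite lexx andbT ler_pM2r; last first.
      by apply: powR_gt0; apply: lt_le_trans nge; rewrite mulr_gt0 ?divr_gt0 ?powR_gt0.
    apply: (@le_trans _ _ 1); last by rewrite le_max lexx.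
    by rewrite invf_le1// le_max lexx.
  have a0 : 0 < ((- t) `^ zt)^-1 by rewrite invr_gt0 powR_gt0.
  have m0 : 0 < ((- t) `^ zx)^-1 by rewrite invr_gt0 powR_gt0.
  have [y0 _ cy] := Uc k _ Ss.
  rewrite (uE _ tT); apply: (rescale_sparse (hsmooth _ Ss) a0 m0 (ltnW hd)
    (divr_gt0 (c0 k) (ltr0n _ 2)) M0 heps b0 (UC k _ Ss) cy (HM _ Ss)).
  have -> : M * d.+1%:R / (eps * ((- t) `^ zx)^-1) = G * (- t) `^ zx.
    by rewrite invfM invrK mulrA.
  have n0 : 0 < n by apply: lt_le_trans nge; rewrite mulr_gt0 ?divr_gt0 ?powR_gt0.
  apply: (@le_trans _ _ (K * (C k `^ (- al) * (- t) `^ (p * al)))); last first.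
    rewrite ler_pM2l// -powal//; exact: powR_opp_le (ltW al0) n0 nle.
  apply: (@le_trans _ _ (G * C k `^ al * T `^ (zx - p * al) *
      (C k `^ (- al) * (- t) `^ (p * al)))); last first.
    by rewrite ler_wpM2r ?mulr_ge0 ?powR_ge0// le_max lexx orbT.
  have -> : G * C k `^ al * T `^ (zx - p * al) * (C k `^ (- al) * (- t) `^ (p * al)) =
      G * (T `^ (zx - p * al) * (- t) `^ (p * al)) * (C k `^ al * C k `^ (- al)) by ring.
  rewrite powR_mulD// subrr powRr0 mulr1 ler_pM2l//.
  have -> : (- t) `^ zx = (- t) `^ (zx - p * al) * (- t) `^ (p * al).
    by rewrite powR_mulD// subrK.
  rewrite ler_pM2r ?powR_gt0//.
  by apply: ge0_ler_powR; rewrite ?nnegrE ?(ltW t0) ?(ltW hT) ?(ltW tT')//; lra.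
have h23 : classZ_uniform eps beta k al T u -> zt <= d%:R * zx / 2.
  move=> [K [K1 HK]]; rewrite zE.
  have /andP[e0 e1] := heps; have /andP[b0 b1] := hbeta.
  have c20 : 0 < c k / 2 by rewrite divr_gt0.
  have th0 : 0 < (1 - beta) / 2 * (c k / 2) by rewrite mulr_gt0// divr_gt0// subr_gt0.
  (* The scale satisfies [ell <= K n^(-al) <= K (c_k / 2)^(-al) tau^(p al)]. Inserted in
     [sparse_rescale_scale] with [m = tau^(-zx)], this bounds a multiple of [tau^(p al - zx)] below
     by a positive constant. *)
  apply: (powR_bounded_below_le0
    (G := L k * C k.+1 * (K * (c k / 2) `^ (- al))) hT th0) => tau ttau.
  have tT : - T < - tau < 0 by lra.
  have [ell [/andP[_]]] := HK _ tT.
  have [n -> /andP[nge _]] := Nbounds _ tT; rewrite opprK in nge.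
  have /andP[t0 _] := ttau; have Ss := sS _ ttau.
  have a0 : 0 < (tau `^ zt)^-1 by rewrite invr_gt0 powR_gt0.
  have m0 : 0 < (tau `^ zx)^-1 by rewrite invr_gt0 powR_gt0.
  have [y0 _ cy] := Uc k _ Ss.
  rewrite (uE _ tT) opprK => ellK /(sparse_rescale_scale (hsmooth _ Ss) a0 m0 c20 e1 hbeta cy
    (UC k.+1 _ Ss)) /le_trans; apply.
  rewrite -/(L k) -[leRHS]mulrA; apply: ler_wpM2l => //.
  have n0 : 0 < (c k / 2) * tau `^ (- p) by rewrite mulr_gt0 ?powR_gt0.
  have := powR_opp_le (ltW al0) n0 nge; rewrite powal// => nle.
  rewrite -powRN -powR_mulD// mulrC (mulrA (K * _)) ler_pM2r ?powR_gt0//.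
  apply: (le_trans ellK); rewrite -mulrA ler_pM2l// (lt_le_trans ltr01)//.
(* In the cycle of implications, the step from finite energy to sparsity passes through the
   exponents. *)
by tfae => [/h13/h32||].
Qed.
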